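(* Let $A$ be a unital algebra with differential graded algebra $(\Omega,\mathrm d)$. Let $(\nabla,\sigma)$ and $(\tilde\nabla,\sigma)$ be torsion free bimodule connections on $\Omega^1$ with the same generalised braiding $\sigma$, and let $\mathcal J^2_A$, $\tilde{\mathcal J}^2_A$ be the second order jet bimodules constructed from them. Then $\mathcal J^2_A\simeq\tilde{\mathcal J}^2_A$ as $A$-bimodules with respect to the bullet actions $\bullet_2$, $\tilde\bullet_2$.
   Context: Everything is over a field. $A$ is a unital algebra and $(\Omega=\oplus_n\Omega^n,\mathrm d)$ is a differential graded algebra with $\Omega^0=A$, product $\wedge$, $\mathrm d^2=0$, graded Leibniz rule and $\Omega$ generated by $A,\mathrm dA$. A bimodule connection $(\nabla,\sigma)$ on $\Omega^1$ is a linear map $\nabla:\Omega^1\to\Omega^1\otimes_A\Omega^1$ and a bimodule map $\sigma:\Omega^1\otimes_A\Omega^1\to\Omega^1\otimes_A\Omega^1$ (the generalised braiding) with $\nabla(a\omega)=\mathrm da\otimes\omega+a\nabla\omega$, $\nabla(\omega a)=(\nabla\omega)a+\sigma(\omega\otimes\mathrm da)$. Torsion free means $\wedge\circ\nabla=\mathrm d$ on $\Omega^1$. The second order jet bimodule of a torsion free $(\nabla,\sigma)$ is $\mathcal J^2_A=A\oplus\Omega^1\oplus\Omega^2_S$, where $\Omega^2_S=\ker\wedge\subseteq\Omega^1\otimes_A\Omega^1$, with actions $a\bullet_2s=as+(\mathrm da)s+(\nabla\mathrm da)s$, $s\bullet_2a=sa+s\,\mathrm da+s\nabla\mathrm da$,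 $a\bullet_2\omega=a\omega+(\mathrm{id}+\sigma)(\mathrm da\otimes\omega)$, $\omega\bullet_2a=\omega a+(\mathrm{id}+\sigma)(\omega\otimes\mathrm da)$, $a\bullet_2(\omega^1\otimes\omega^2)=a\omega^1\otimes\omega^2$, $(\omega^1\otimes\omega^2)\bullet_2a=\omega^1\otimes\omega^2a$ for $a,s\in A$, $\omega\in\Omega^1$, $\omega^1\otimes\omega^2\in\Omega^2_S$. $\tilde{\mathcal J}^2_A$ with $\tilde\bullet_2$ is defined in the same way from $(\tilde\nabla,\sigma)$. *)

(* Defs.v *)
From HB Require Import structures.
From mathcomp Require Import all_boot all_algebra.
(* boolp is only used to decide the congruence defining the tensor product. *)
From mathcomp Require Import boolp.

Set Implicit Arguments.
Unset Strict Implicit.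
Unset Printing Implicit Defensive.

Import GRing.Theory.
Local Open Scope ring_scope.
Local Open Scope quotient_scope.

Declare Scope bimod_scope.
Delimit Scope bimod_scope with bimod.
Local Open Scope bimod_scope.

Reserved Notation "a *> v" (at level 40, left associativity).
Reserved Notation "v <* a" (at level 40, left associativity).
Reserved Notation "M ⊗ N" (at level 40, left associativity).

(* k acts in the same way from both sides, through the axioms lactZl, lactZr,
   ractZl and ractZr. *)
HB.mixin Record Lmodule_isBimodule (k : fieldType) (A : algType k) V
    of GRing.Lmodule k V := {
  lact : A -> V -> V;
  ract : V -> A -> V;
  lact1 : forall v, lact 1 v = v;
  lactM : forall a b v, lact (a * b) v = lact a (lact b v);
  lactDl : forall a b v, lact (a + b) v = lact a v + lact b v;
  lactDr : forall a v w, lact a (v + w) = lact a v + lact a w;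
  lactZl : forall (c : k) a v, lact (c *: a) v = c *: lact a v;
  lactZr : forall (c : k) a v, lact a (c *: v) = c *: lact a v;
  ract1 : forall v, ract v 1 = v;
  ractM : forall a b v, ract v (a * b) = ract (ract v a) b;
  ractDl : forall a v w, ract (v + w) a = ract v a + ract w a;
  ractDr : forall a b v, ract v (a + b) = ract v a + ract v b;
  ractZl : forall (c : k) a v, ract (c *: v) a = c *: ract v a;
  ractZr : forall (c : k) a v, ract v (c *: a) = c *: ract v a;
  lractA : forall a v b, ract (lact a v) b = lact a (ract v b)
}.

#[short(type="bimodType")]
HB.structure Definition Bimodule (k : fieldType) (A : algType k) :=
  {V of Lmodule_isBimodule k A V & GRing.Lmodule k V}.

Notation "a *> v" := (lact a v) : bimod_scope.
Notation "v <* a" := (ract v a) : bimod_scope.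

Section BimoduleTheory.
Context (k : fieldType) (A : algType k).
Implicit Types V W : bimodType A.

Definition bimod_morphism V W (f : V -> W) : Prop :=
  [/\ linear f, forall a v, f (a *> v) = a *> f v
    & forall v a, f (v <* a) = f v <* a].

Definition bimod_isomorphic V W : Prop :=
  exists2 f : V -> W, bimod_morphism f & bijective f.

Lemma lact0 V (a : A) : a *> (0 : V) = 0.
Proof. by apply: (@addIr _ (a *> 0)); rewrite add0r -lactDr addr0. Qed.

Lemma ract0 V (a : A) : (0 : V) <* a = 0.
Proof. by apply: (@addIr _ (0 <* a)); rewrite add0r -ractDl addr0. Qed.

Lemma lactN V (a : A) (v : V) : a *> (- v) = - (a *> v).
Proof. by apply/eqP; rewrite -addr_eq0 -lactDr addNr lact0. Qed.

Lemma ractN V (a : A) (v : V) : (- v) <* a = - (v <* a).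
Proof. by apply/eqP; rewrite -addr_eq0 -ractDl addNr ract0. Qed.

End BimoduleTheory.

(* A finite formal sum of pure tensors is a list of pairs; tens_eq is the
   congruence generated by commutativity, biadditivity and A-balancedness.
   The scalars and the additive inverse are absorbed in the left factor. *)
Section Tensor.
Context (k : fieldType) (A : algType k) (M N : bimodType A).

Inductive tens_eq : seq (M * N) -> seq (M * N) -> Prop :=
| te_refl s : tens_eq s s
| te_sym s t : tens_eq s t -> tens_eq t s
| te_trans s t u : tens_eq s t -> tens_eq t u -> tens_eq s u
| te_cat s s' t t' : tens_eq s s' -> tens_eq t t' ->
    tens_eq (s ++ t) (s' ++ t')
| te_comm s t : tens_eq (s ++ t) (t ++ s)
| te_zero n : tens_eq [:: (0, n)] [::]
| te_addl m m' n : tens_eq [:: (m + m', n)] [:: (m, n); (m', n)]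
| te_addr m n n' : tens_eq [:: (m, n + n')] [:: (m, n); (m, n')]
| te_bal m a n : tens_eq [:: (m <* a, n)] [:: (m, a *> n)].

Definition tens_eqb (s t : seq (M * N)) : bool := `[< tens_eq s t >].

Lemma tens_eqb_equiv : equiv_class_of tens_eqb.
Proof.
split=> [s|s t|t s u].
- by apply/asboolP/te_refl.
- by apply/asboolP/asboolP; apply: te_sym.
- by move=> /asboolP st /asboolP tu; apply/asboolP; apply: te_trans tu.
Qed.

Canonical tens_equiv := EquivRelPack tens_eqb_equiv.

Definition tensor : Type := {eq_quot tens_equiv}.
HB.instance Definition _ := Choice.on tensor.
HB.instance Definition _ := EqQuotient.on tensor.

Lemma tens_eqP s t : \pi_tensor s = \pi_tensor t <-> tens_eq s t.
Proof.
split=> [/eqmodP/asboolP // | st].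
by apply/eqmodP/asboolP.
Qed.

Definition tens (m : M) (n : N) : tensor := \pi_tensor [:: (m, n)].

Definition tens_map (f : M -> M) (g : N -> N) (t : tensor) : tensor :=
  \pi_tensor [seq (f p.1, g p.2) | p <- repr t].

Lemma tens_repr s : tens_eq (repr (\pi_tensor s)) s.
Proof. by apply/tens_eqP; rewrite reprK. Qed.

Lemma tens_mapE f g s :
    {morph f : x y / x + y} -> {morph g : x y / x + y} ->
    (forall m a n, tens_eq [:: (f (m <* a), g n)] [:: (f m, g (a *> n))]) ->
  tens_map f g (\pi_tensor s) = \pi_tensor [seq (f p.1, g p.2) | p <- s].
Proof.
move=> fD gD bal; rewrite /tens_map; apply/tens_eqP.
move: (repr _) (tens_repr s) => r; elim=> {r s} /=.
- by move=> s; apply: te_refl.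
- by move=> s t _; apply: te_sym.
- by move=> s t u _ st _; apply: te_trans.
- by move=> s s' t t' _ ss _ tt; rewrite !map_cat; apply: te_cat.
- by move=> s t; rewrite !map_cat; apply: te_comm.
- move=> n; suff -> : f 0 = 0 by apply: te_zero.
  by apply: (@addIr _ (f 0)); rewrite add0r -fD addr0.
- by move=> m m' n; rewrite fD; apply: te_addl.
- by move=> m n n'; rewrite gD; apply: te_addr.
- exact: bal.
Qed.

Definition tens_zero : tensor := \pi_tensor [::].
Definition tens_add (t u : tensor) : tensor := \pi_tensor (repr t ++ repr u).
Definition tens_opp : tensor -> tensor := tens_map -%R id.
Definition tens_scale (c : k) : tensor -> tensor := tens_map ( *:%R c) id.
Definition tens_lact (a : A) : tensor -> tensor := tens_map (lact a) id.
Definition tens_ract (t : tensor) (a : A) : tensor := tens_map id (ract^~ a) t.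

Lemma tens_addE s t :
  tens_add (\pi_tensor s) (\pi_tensor t) = \pi_tensor (s ++ t).
Proof. by apply/tens_eqP; apply: te_cat; apply: tens_repr. Qed.

Lemma tens_oppE s :
  tens_opp (\pi_tensor s) = \pi_tensor [seq (- p.1, p.2) | p <- s].
Proof.
apply: tens_mapE => // [x y|m a n]; first exact: opprD.
by rewrite -ractN; apply: te_bal.
Qed.

Lemma tens_scaleE c s :
  tens_scale c (\pi_tensor s) = \pi_tensor [seq (c *: p.1, p.2) | p <- s].
Proof.
apply: tens_mapE => // [x y|m a n]; first exact: scalerDr.
by rewrite -ractZl; apply: te_bal.
Qed.

Lemma tens_lactE a s :
  tens_lact a (\pi_tensor s) = \pi_tensor [seq (a *> p.1, p.2) | p <- s].
Proof.
apply: tens_mapE => // [x y|m b n]; first exact: lactDr.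
by rewrite /= -lractA; apply: te_bal.
Qed.

Lemma tens_ractE a s :
  tens_ract (\pi_tensor s) a = \pi_tensor [seq (p.1, p.2 <* a) | p <- s].
Proof.
apply: tens_mapE => // [x y|m b n]; first exact: ractDl.
by rewrite /= lractA; apply: te_bal.
Qed.

Lemma tens_quotW (P : tensor -> Prop) :
  (forall s, P (\pi_tensor s)) -> forall t, P t.
Proof. by move=> H t; rewrite -[t]reprK; apply: H. Qed.

Lemma tens_addA : associative tens_add.
Proof.
elim/tens_quotW=> s; elim/tens_quotW=> t; elim/tens_quotW=> u.
by rewrite !tens_addE catA.
Qed.

Lemma tens_addC : commutative tens_add.
Proof.
elim/tens_quotW=> s; elim/tens_quotW=> t; rewrite !tens_addE.
by apply/tens_eqP/te_comm.
Qed.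

Lemma tens_add0 : left_id tens_zero tens_add.
Proof. by elim/tens_quotW=> s; rewrite /tens_zero tens_addE. Qed.

Lemma tens_addN : left_inverse tens_zero tens_opp tens_add.
Proof.
elim/tens_quotW=> s; rewrite tens_oppE tens_addE; apply/tens_eqP.
elim: s => [|[m n] s IH] /=; first exact: te_refl.
apply: (@te_trans _ ([:: (- m, n); (m, n)] ++
                     ([seq (- p.1, p.2) | p <- s] ++ s))).
  rewrite -[_ :: _ ++ _]/([:: (- m, n)] ++ (_ ++ _)).
  rewrite -[[:: _; _] ++ _]/([:: (- m, n)] ++ ([:: (m, n)] ++ _)).
  apply: te_cat; first exact: te_refl.
  rewrite -[_ :: s]/([:: _] ++ s) !catA; apply: te_cat; last exact: te_refl.
  exact: te_comm.
rewrite -[[::]]/([::] ++ [::]); apply: te_cat => //.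
apply: te_trans (te_zero n).
by rewrite -(addNr m); apply/te_sym/te_addl.
Qed.

HB.instance Definition _ :=
  GRing.isZmodule.Build tensor tens_addA tens_addC tens_add0 tens_addN.

Lemma tens_addrE s t :
  \pi_tensor s + \pi_tensor t = \pi_tensor (s ++ t) :> tensor.
Proof. exact: tens_addE. Qed.

Lemma pi_tensE s : \pi_tensor s = \sum_(p <- s) tens p.1 p.2.
Proof.
elim: s => [|[m n] s IH]; first by rewrite big_nil.
by rewrite big_cons -IH [RHS]tens_addrE.
Qed.

Lemma tensDl m m' n : tens (m + m') n = tens m n + tens m' n.
Proof. by rewrite [RHS]tens_addrE; apply/tens_eqP/te_addl. Qed.

Lemma tensDr m n n' : tens m (n + n') = tens m n + tens m n'.
Proof. by rewrite [RHS]tens_addrE; apply/tens_eqP/te_addr. Qed.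

Lemma tens_bal m a n : tens (m <* a) n = tens m (a *> n).
Proof. by apply/tens_eqP/te_bal. Qed.

Lemma tensor_ind (P : tensor -> Prop) :
  P 0 -> (forall t u, P t -> P u -> P (t + u)) -> (forall m n, P (tens m n)) ->
  forall t, P t.
Proof.
move=> P0 PD Pt; elim/tens_quotW=> s; rewrite pi_tensE.
by apply: (big_ind P) => // p _; apply: Pt.
Qed.

Lemma tens_scaleD c : {morph tens_scale c : t u / t + u}.
Proof.
elim/tens_quotW=> s; elim/tens_quotW=> t.
by rewrite tens_addrE !tens_scaleE [RHS]tens_addrE map_cat.
Qed.

Lemma tens_lactD a : {morph tens_lact a : t u / t + u}.
Proof.
elim/tens_quotW=> s; elim/tens_quotW=> t.
by rewrite tens_addrE !tens_lactE [RHS]tens_addrE map_cat.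
Qed.

Lemma tens_ractD a : {morph tens_ract^~ a : t u / t + u}.
Proof.
elim/tens_quotW=> s; elim/tens_quotW=> t.
by rewrite tens_addrE !tens_ractE [RHS]tens_addrE map_cat.
Qed.

Lemma tens_morph0 (f : tensor -> tensor) :
  {morph f : t u / t + u} -> f 0 = 0.
Proof. by move=> fD; apply: (@addIr _ (f 0)); rewrite add0r -fD addr0. Qed.

Lemma tens_scaleA c d t : tens_scale c (tens_scale d t) = tens_scale (c * d) t.
Proof.
elim/tens_quotW: t => s; rewrite !tens_scaleE -map_comp.
by congr (\pi _); apply: eq_map => p /=; rewrite scalerA.
Qed.

Lemma tens_scale1 : left_id 1 tens_scale.
Proof.
elim/tens_quotW=> s; rewrite tens_scaleE; congr (\pi _).
by rewrite -[RHS]map_id; apply: eq_map => -[m n] /=; rewrite scale1r.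
Qed.

Lemma tens_scaleDl t : {morph tens_scale^~ t : c d / c + d}.
Proof.
move=> c d; elim/tensor_ind: t => [|t u IHt IHu|m n].
- by rewrite !(tens_morph0 (@tens_scaleD _)) addr0.
- by rewrite !tens_scaleD IHt IHu addrACA.
- by rewrite !tens_scaleE /= scalerDl [LHS]tensDl.
Qed.

HB.instance Definition _ := GRing.Zmodule_isLmodule.Build k tensor
  tens_scaleA tens_scale1 tens_scaleD tens_scaleDl.

Lemma scale_tens c m n : c *: tens m n = tens (c *: m) n.
Proof. exact: tens_scaleE. Qed.

Lemma tens_lact_tens a m n : tens_lact a (tens m n) = tens (a *> m) n.
Proof. exact: tens_lactE. Qed.

Lemma tens_ract_tens a m n : tens_ract (tens m n) a = tens m (n <* a).
Proof. exact: tens_ractE. Qed.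

Let lD := tens_lactD.
Let rD := tens_ractD.
Let l0 a : tens_lact a 0 = 0. Proof. exact: tens_morph0 (@lD a). Qed.
Let r0 a : tens_ract 0 a = 0. Proof. exact: tens_morph0 (@rD a). Qed.
Let lT := tens_lact_tens.
Let rT := tens_ract_tens.

Let tens_lact1 t : tens_lact 1 t = t.
Proof.
by elim/tensor_ind: t => [|t u IHt IHu|m n]; rewrite ?l0 ?lD ?IHt ?IHu ?lT ?lact1.
Qed.
Let tens_lactM a b t : tens_lact (a * b) t = tens_lact a (tens_lact b t).
Proof.
by elim/tensor_ind: t => [|t u IHt IHu|m n];
  rewrite ?l0 ?lD ?IHt ?IHu ?lT ?lactM // !lD.
Qed.
Let tens_lactDl a b t : tens_lact (a + b) t = tens_lact a t + tens_lact b t.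
Proof.
elim/tensor_ind: t => [|t u IHt IHu|m n]; first by rewrite !l0 addr0.
  by rewrite !lD IHt IHu addrACA.
by rewrite !lT lactDl tensDl.
Qed.
Let tens_lactZl (c : k) a t : tens_lact (c *: a) t = c *: tens_lact a t.
Proof.
elim/tensor_ind: t => [|t u IHt IHu|m n]; first by rewrite !l0 scaler0.
  by rewrite !lD IHt IHu scalerDr.
by rewrite !lT lactZl scale_tens.
Qed.
Let tens_lactZr (c : k) a t : tens_lact a (c *: t) = c *: tens_lact a t.
Proof.
elim/tensor_ind: t => [|t u IHt IHu|m n]; first by rewrite scaler0 !l0 scaler0.
  by rewrite scalerDr !lD IHt IHu scalerDr.
by rewrite scale_tens !lT lactZr scale_tens.
Qed.
Let tens_ract1 t : tens_ract t 1 = t.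
Proof.
by elim/tensor_ind: t => [|t u IHt IHu|m n]; rewrite ?r0 ?rD ?IHt ?IHu ?rT ?ract1.
Qed.
Let tens_ractM a b t : tens_ract t (a * b) = tens_ract (tens_ract t a) b.
Proof.
by elim/tensor_ind: t => [|t u IHt IHu|m n];
  rewrite ?r0 ?rD ?IHt ?IHu ?rT ?ractM // !rD.
Qed.
Let tens_ractDr a b t : tens_ract t (a + b) = tens_ract t a + tens_ract t b.
Proof.
elim/tensor_ind: t => [|t u IHt IHu|m n]; first by rewrite !r0 addr0.
  by rewrite !rD IHt IHu addrACA.
by rewrite !rT ractDr tensDr.
Qed.
Let tens_ractZl (c : k) a t : tens_ract (c *: t) a = c *: tens_ract t a.
Proof.
elim/tensor_ind: t => [|t u IHt IHu|m n]; first by rewrite scaler0 !r0 scaler0.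
  by rewrite scalerDr !rD IHt IHu scalerDr.
by rewrite scale_tens !rT scale_tens.
Qed.

Lemma tens_scaler c m n : tens m (c *: n) = c *: tens m n.
Proof.
rewrite -{1}[n](lact1 (s := N)) -lactZl -tens_bal.
by rewrite ractZr ract1 -scale_tens.
Qed.

Let tens_ractZr (c : k) a t : tens_ract t (c *: a) = c *: tens_ract t a.
Proof.
elim/tensor_ind: t => [|t u IHt IHu|m n]; first by rewrite !r0 scaler0.
  by rewrite !rD IHt IHu scalerDr.
by rewrite !rT ractZr tens_scaler.
Qed.
Let tens_lractA a t b :
  tens_ract (tens_lact a t) b = tens_lact a (tens_ract t b).
Proof.
elim/tensor_ind: t => [|t u IHt IHu|m n]; first by rewrite !(l0, r0).
  by rewrite !(lD, rD) IHt IHu.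
by rewrite !(lT, rT).
Qed.

HB.instance Definition _ := Lmodule_isBimodule.Build k A tensor
  tens_lact1 tens_lactM tens_lactDl tens_lactD tens_lactZl tens_lactZr
  tens_ract1 tens_ractM tens_ractD tens_ractDr tens_ractZl tens_ractZr
  tens_lractA.

Lemma lact_tens a m n : a *> tens m n = tens (a *> m) n.
Proof. exact: lT. Qed.

Lemma ract_tens a m n : tens m n <* a = tens m (n <* a).
Proof. exact: rT. Qed.

(* The map induced by f; meaningful when f is biadditive and A-balanced. *)
Definition tens_lift (Z : zmodType) (f : M -> N -> Z) (t : tensor) : Z :=
  \sum_(p <- repr t) f p.1 p.2.

Section Lift.
Context (Z : zmodType) (f : M -> N -> Z).
Hypotheses (fDl : forall m m' n, f (m + m') n = f m n + f m' n)
           (fDr : forall m n n', f m (n + n') = f m n + f m n')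
           (fbal : forall m a n, f (m <* a) n = f m (a *> n)).

Lemma tens_lift_pi s :
  tens_lift f (\pi_tensor s) = \sum_(p <- s) f p.1 p.2.
Proof.
rewrite /tens_lift; move: (repr _) (tens_repr s) => r; elim=> {r s} //=.
- by move=> s t u _ -> _ ->.
- by move=> s s' t t' _ ss _ tt; rewrite !big_cat /= ss tt.
- by move=> s t; rewrite !big_cat /= addrC.
- move=> n; rewrite big_seq1 big_nil /=.
  by apply: (@addIr _ (f 0 n)); rewrite add0r -fDl addr0.
- by move=> m m' n; rewrite !big_cons !big_nil !addr0 /=.
- by move=> m n n'; rewrite !big_cons !big_nil !addr0 /=.
- by move=> m a n; rewrite !big_seq1 /=.
Qed.

Lemma tens_liftE m n : tens_lift f (tens m n) = f m n.
Proof. by rewrite tens_lift_pi big_seq1. Qed.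

Lemma tens_liftD : {morph tens_lift f : t u / t + u}.
Proof.
elim/tens_quotW=> s; elim/tens_quotW=> t.
by rewrite tens_addrE !tens_lift_pi big_cat.
Qed.

Lemma tens_lift0 : tens_lift f 0 = 0.
Proof. by apply: (@addIr _ (tens_lift f 0)); rewrite add0r -tens_liftD addr0. Qed.

End Lift.

End Tensor.

Notation "M ⊗ N" := (tensor M N) : type_scope.
Notation "x ⊗ y" := (tens x y) : bimod_scope.

(* The total algebra Ω = ⊕_n Ω^n, its homogeneous components being given by
   the predicates dga_deg n; dga_inj identifies A with Ω^0. In dga_gen, closure
   under scalars is implied, as they are images of scalars of A. *)
Record dga (k : fieldType) (A : algType k) := Dga {
  dga_alg :> algType k;
  dga_deg : nat -> {pred dga_alg};
  dga_inj : {lrmorphism A -> dga_alg};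
  dga_d : {linear dga_alg -> dga_alg};
  dga_deg_submod : forall n, submod_closed (dga_deg n);
  dga_deg_sum : forall x, exists n (f : nat -> dga_alg),
    (forall i, f i \in dga_deg i) /\ x = \sum_(i < n) f i;
  dga_deg_direct : forall n (f : nat -> dga_alg),
    (forall i, f i \in dga_deg i) -> \sum_(i < n) f i = 0 ->
    forall i, (i < n)%N -> f i = 0;
  dga_degM : forall m n x y,
    x \in dga_deg m -> y \in dga_deg n -> x * y \in dga_deg (m + n);
  dga_inj_inj : injective dga_inj;
  dga_deg0 : forall x, x \in dga_deg 0 <-> exists a, x = dga_inj a;
  dga_degd : forall n x, x \in dga_deg n -> dga_d x \in dga_deg n.+1;
  dga_dd : forall x, dga_d (dga_d x) = 0;
  dga_leibniz : forall n x y, x \in dga_deg n ->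
    dga_d (x * y) = dga_d x * y + (-1) ^+ n * (x * dga_d y);
  dga_gen : forall S : dga_alg -> Prop,
    (forall a, S (dga_inj a)) -> (forall a, S (dga_d (dga_inj a))) ->
    (forall x y, S x -> S y -> S (x + y)) ->
    (forall x y, S x -> S y -> S (x * y)) ->
    forall x, S x
}.

Arguments dga_deg {k A} d n _.
Arguments dga_inj {k A} d.
Arguments dga_d {k A} d.
Arguments dga_deg_submod {k A} d n.

Section Forms.
Context (k : fieldType) (A : algType k) (Om : dga A).
Local Notation inj := (dga_inj Om).
Local Notation d := (dga_d Om).

Lemma dga_inj_deg a : inj a \in dga_deg Om 0.
Proof. by apply/dga_deg0; exists a. Qed.

HB.instance Definition _ n :=
  GRing.isSubmodClosed.Build k Om (dga_deg Om n)
    (GRing.submod_closed_semi (dga_deg_submod Om n)).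

Record diffform (n : nat) :=
  Form { form_val : Om; form_deg : form_val \in dga_deg Om n }.

HB.instance Definition _ n := [isSub for @form_val n].
HB.instance Definition _ n := [Choice of diffform n by <:].
HB.instance Definition _ n := [SubChoice_isSubLmodule of diffform n by <:].

Section FormBimodule.
Context (n : nat).

Lemma form_lact_deg a (w : diffform n) : inj a * val w \in dga_deg Om n.
Proof. exact: dga_degM (dga_inj_deg a) (form_deg w). Qed.

Lemma form_ract_deg (w : diffform n) a : val w * inj a \in dga_deg Om n.
Proof. by have := dga_degM (form_deg w) (dga_inj_deg a); rewrite addn0. Qed.

Definition form_lact a (w : diffform n) : diffform n := Form (form_lact_deg a w).
Definition form_ract (w : diffform n) a : diffform n := Form (form_ract_deg w a).

Fact form_lact1 v : form_lact 1 v = v.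
Proof. by apply: val_inj; rewrite /= rmorph1 mul1r. Qed.
Fact form_lactM a b v : form_lact (a * b) v = form_lact a (form_lact b v).
Proof. by apply: val_inj; rewrite /= rmorphM mulrA. Qed.
Fact form_lactDl a b v : form_lact (a + b) v = form_lact a v + form_lact b v.
Proof. by apply: val_inj; rewrite /= rmorphD mulrDl. Qed.
Fact form_lactDr a v w : form_lact a (v + w) = form_lact a v + form_lact a w.
Proof. by apply: val_inj; rewrite /= mulrDr. Qed.
Fact form_lactZl (c : k) a v : form_lact (c *: a) v = c *: form_lact a v.
Proof. by apply: val_inj; rewrite /= linearZ /= scalerAl. Qed.
Fact form_lactZr (c : k) a v : form_lact a (c *: v) = c *: form_lact a v.
Proof. by apply: val_inj; rewrite /= scalerAr. Qed.
Fact form_ract1 v : form_ract v 1 = v.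
Proof. by apply: val_inj; rewrite /= rmorph1 mulr1. Qed.
Fact form_ractM a b v : form_ract v (a * b) = form_ract (form_ract v a) b.
Proof. by apply: val_inj; rewrite /= rmorphM mulrA. Qed.
Fact form_ractDl a v w : form_ract (v + w) a = form_ract v a + form_ract w a.
Proof. by apply: val_inj; rewrite /= mulrDl. Qed.
Fact form_ractDr a b v : form_ract v (a + b) = form_ract v a + form_ract v b.
Proof. by apply: val_inj; rewrite /= rmorphD mulrDr. Qed.
Fact form_ractZl (c : k) a v : form_ract (c *: v) a = c *: form_ract v a.
Proof. by apply: val_inj; rewrite /= scalerAl. Qed.
Fact form_ractZr (c : k) a v : form_ract v (c *: a) = c *: form_ract v a.
Proof. by apply: val_inj; rewrite /= linearZ /= scalerAr. Qed.
Fact form_lractA a v b :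
  form_ract (form_lact a v) b = form_lact a (form_ract v b).
Proof. by apply: val_inj; rewrite /= mulrA. Qed.

HB.instance Definition _ := Lmodule_isBimodule.Build k A (diffform n)
  form_lact1 form_lactM form_lactDl form_lactDr form_lactZl form_lactZr
  form_ract1 form_ractM form_ractDl form_ractDr form_ractZl form_ractZr
  form_lractA.

Lemma val_lact a (w : diffform n) : val (a *> w) = inj a * val w.
Proof. by []. Qed.

Lemma val_ract (w : diffform n) a : val (w <* a) = val w * inj a.
Proof. by []. Qed.

Lemma form_d_deg (w : diffform n) : d (val w) \in dga_deg Om n.+1.
Proof. exact/dga_degd/form_deg. Qed.

Definition form_d (w : diffform n) : diffform n.+1 := Form (form_d_deg w).

End FormBimodule.

Definition form_mul m n (w : diffform m) (v : diffform n) : diffform (m + n) :=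
  Form (dga_degM (form_deg w) (form_deg v)).

Definition dA (a : A) : diffform 1 := Form (dga_degd (dga_inj_deg a)).

(* The product Ω^1 ⊗_A Ω^1 -> Ω^2. *)
Definition wedge : diffform 1 ⊗ diffform 1 -> diffform 2 :=
  tens_lift (@form_mul 1 1).

Definition ker_wedge : {pred diffform 1 ⊗ diffform 1} := fun t => wedge t == 0.

Let mulDl (m m' n : diffform 1) : form_mul (m + m') n = form_mul m n + form_mul m' n.
Proof. by apply: val_inj; rewrite /= mulrDl. Qed.
Let mulDr (m n n' : diffform 1) : form_mul m (n + n') = form_mul m n + form_mul m n'.
Proof. by apply: val_inj; rewrite /= mulrDr. Qed.
Let mul_bal (m : diffform 1) a (n : diffform 1) :
  form_mul (m <* a) n = form_mul m (a *> n).
Proof. by apply: val_inj; rewrite /= mulrA. Qed.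

Lemma wedgeE (w v : diffform 1) : wedge (w ⊗ v) = form_mul w v.
Proof. exact: tens_liftE. Qed.

Lemma wedgeD : {morph wedge : t u / t + u}.
Proof. exact: tens_liftD. Qed.

Lemma wedge0 : wedge 0 = 0.
Proof. exact: tens_lift0. Qed.

Lemma wedgeZ c t : wedge (c *: t) = c *: wedge t.
Proof.
elim/tensor_ind: t => [|t u IHt IHu|m n].
- by rewrite scaler0 wedge0 scaler0.
- by rewrite scalerDr !wedgeD IHt IHu scalerDr.
- by rewrite scale_tens !wedgeE; apply: val_inj; rewrite /= scalerAl.
Qed.

Lemma wedge_lact a t : wedge (a *> t) = a *> wedge t.
Proof.
elim/tensor_ind: t => [|t u IHt IHu|m n].
- by rewrite lact0 wedge0 lact0.
- by rewrite lactDr !wedgeD IHt IHu lactDr.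
- by rewrite lact_tens !wedgeE; apply: val_inj; rewrite /= mulrA.
Qed.

Lemma wedge_ract t a : wedge (t <* a) = wedge t <* a.
Proof.
elim/tensor_ind: t => [|t u IHt IHu|m n].
- by rewrite ract0 wedge0 ract0.
- by rewrite ractDl !wedgeD IHt IHu ractDl.
- by rewrite ract_tens !wedgeE; apply: val_inj; rewrite /= mulrA.
Qed.

Fact ker_wedge_submod : submod_closed ker_wedge.
Proof.
split=> [|c t u]; rewrite !unfold_in; first by rewrite wedge0.
by move=> /eqP ht /eqP hu; rewrite wedgeD wedgeZ ht hu scaler0 addr0.
Qed.

HB.instance Definition _ :=
  GRing.isSubmodClosed.Build k (diffform 1 ⊗ diffform 1)%type ker_wedge
    (GRing.submod_closed_semi ker_wedge_submod).

Lemma ker_wedgeP t : reflect (wedge t = 0) (t \in ker_wedge).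
Proof. exact: eqP. Qed.

(* Ω^2_S = ker(wedge) *)
Record form2S := Form2S { form2S_val : diffform 1 ⊗ diffform 1;
                          form2S_ker : form2S_val \in ker_wedge }.

HB.instance Definition _ := [isSub for form2S_val].
HB.instance Definition _ := [Choice of form2S by <:].
HB.instance Definition _ := [SubChoice_isSubLmodule of form2S by <:].

Fact form2S_lact_ker a (t : form2S) : a *> val t \in ker_wedge.
Proof. by apply/ker_wedgeP; rewrite wedge_lact (ker_wedgeP _ (valP t)) lact0. Qed.

Fact form2S_ract_ker (t : form2S) a : val t <* a \in ker_wedge.
Proof. by apply/ker_wedgeP; rewrite wedge_ract (ker_wedgeP _ (valP t)) ract0. Qed.

Definition form2S_lact a t : form2S := Form2S (form2S_lact_ker a t).
Definition form2S_ract t a : form2S := Form2S (form2S_ract_ker t a).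

Fact form2S_lact1 v : form2S_lact 1 v = v.
Proof. by apply: val_inj; rewrite /= lact1. Qed.
Fact form2S_lactM a b v :
  form2S_lact (a * b) v = form2S_lact a (form2S_lact b v).
Proof. by apply: val_inj; rewrite /= lactM. Qed.
Fact form2S_lactDl a b v :
  form2S_lact (a + b) v = form2S_lact a v + form2S_lact b v.
Proof. by apply: val_inj; rewrite /= lactDl. Qed.
Fact form2S_lactDr a v w :
  form2S_lact a (v + w) = form2S_lact a v + form2S_lact a w.
Proof. by apply: val_inj; rewrite /= lactDr. Qed.
Fact form2S_lactZl (c : k) a v :
  form2S_lact (c *: a) v = c *: form2S_lact a v.
Proof. by apply: val_inj; rewrite /= lactZl. Qed.
Fact form2S_lactZr (c : k) a v :
  form2S_lact a (c *: v) = c *: form2S_lact a v.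
Proof. by apply: val_inj; rewrite /= lactZr. Qed.
Fact form2S_ract1 v : form2S_ract v 1 = v.
Proof. by apply: val_inj; rewrite /= ract1. Qed.
Fact form2S_ractM a b v :
  form2S_ract v (a * b) = form2S_ract (form2S_ract v a) b.
Proof. by apply: val_inj; rewrite /= ractM. Qed.
Fact form2S_ractDl a v w :
  form2S_ract (v + w) a = form2S_ract v a + form2S_ract w a.
Proof. by apply: val_inj; rewrite /= ractDl. Qed.
Fact form2S_ractDr a b v :
  form2S_ract v (a + b) = form2S_ract v a + form2S_ract v b.
Proof. by apply: val_inj; rewrite /= ractDr. Qed.
Fact form2S_ractZl (c : k) a v :
  form2S_ract (c *: v) a = c *: form2S_ract v a.
Proof. by apply: val_inj; rewrite /= ractZl. Qed.
Fact form2S_ractZr (c : k) a v :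
  form2S_ract v (c *: a) = c *: form2S_ract v a.
Proof. by apply: val_inj; rewrite /= ractZr. Qed.
Fact form2S_lractA a v b :
  form2S_ract (form2S_lact a v) b = form2S_lact a (form2S_ract v b).
Proof. by apply: val_inj; rewrite /= lractA. Qed.

HB.instance Definition _ := Lmodule_isBimodule.Build k A form2S
  form2S_lact1 form2S_lactM form2S_lactDl form2S_lactDr form2S_lactZl
  form2S_lactZr form2S_ract1 form2S_ractM form2S_ractDl form2S_ractDr
  form2S_ractZl form2S_ractZr form2S_lractA.

Lemma dA_M a b : dA (a * b) = dA a <* b + a *> dA b.
Proof.
apply: val_inj; rewrite /= rmorphM (dga_leibniz _ (dga_inj_deg a)).
by rewrite expr0 mul1r.
Qed.

Lemma dA_D a b : dA (a + b) = dA a + dA b.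
Proof. by apply: val_inj; rewrite /= !linearD. Qed.

Lemma dA_Z c a : dA (c *: a) = c *: dA a.
Proof. by apply: val_inj; rewrite /= !linearZ. Qed.

Lemma dA1 : dA 1 = 0.
Proof.
have := dA_M 1 1; rewrite mulr1 ract1 lact1 => /(congr1 (fun x => x - dA 1)).
by rewrite subrr addrK.
Qed.

Inductive dspan : Om -> Prop :=
| dspan0 : dspan 0
| dspanD v w : dspan v -> dspan w -> dspan (v + w)
| dspan_gen a b c : dspan (inj a * d (inj b) * inj c).

(* Ω^1 is spanned by the a db c, because Ω is generated by A and dA. *)
Lemma form1_ind (P : diffform 1 -> Prop) :
  P 0 -> (forall v w, P v -> P w -> P (v + w)) ->
  (forall a b c, P (a *> dA b <* c)) -> forall w, P w.
Proof.
move=> P0 PD PdA w.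
(* H collects the elements all of whose components have degree >= 2. *)
pose H (x : Om) := exists n (f : nat -> Om),
  (forall i, f i \in dga_deg Om i.+2) /\ x = \sum_(i < n) f i.
have Ql a x : dspan x -> dspan (inj a * x).
  elim=> [|u v _ qu _ qv|b c e].
  - by rewrite mulr0; apply: dspan0.
  - by rewrite mulrDr; apply: dspanD.
  - by rewrite !mulrA -rmorphM; apply: dspan_gen.
have Qr x a : dspan x -> dspan (x * inj a).
  elim=> [|u v _ qu _ qv|b c e].
  - by rewrite mul0r; apply: dspan0.
  - by rewrite mulrDl; apply: dspanD.
  - by rewrite -!mulrA -rmorphM !mulrA; apply: dspan_gen.
have Q1 x : dspan x -> x \in dga_deg Om 1.
  elim=> [|u v _ qu _ qv|a b c].
  - exact: rpred0.
  - exact: rpredD.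
  - exact: (form_deg (a *> dA b <* c)).
have H1 n x : x \in dga_deg Om n.+2 -> H x.
  move=> xn; exists n.+1, (fun i => if i == n then x else 0); split.
    by move=> i; case: eqP => [->|_] //; apply: rpred0.
  rewrite big_ord_recr /= eqxx big1 ?add0r // => i _.
  by rewrite ltn_eqF ?ltn_ord.
have H0 : H 0 by apply: (H1 0%N); apply: rpred0.
have HD x y : H x -> H y -> H (x + y).
  move=> [m [f [fP ->]]] [n [g [gP ->]]].
  exists (m + n)%N, (fun i => (if (i < m)%N then f i else 0) +
                     (if (i < n)%N then g i else 0)); split.
    by move=> i; apply: rpredD; case: ifP => // _; apply: rpred0.
  rewrite big_split /=; congr (_ + _).
    rewrite [RHS]big_split_ord /= [X in _ + X]big1 ?addr0; last first.
      by move=> i _; rewrite ltnNge leq_addr.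
    by apply: eq_bigr => i _; rewrite ltn_ord.
  rewrite addnC [RHS]big_split_ord /= [X in _ + X]big1 ?addr0; last first.
    by move=> i _; rewrite ltnNge leq_addr.
  by apply: eq_bigr => i _; rewrite ltn_ord.
have HMr x y : H x -> H (x * y).
  move=> [m [f [fP ->]]]; have [n [g [gP ->]]] := dga_deg_sum y.
  rewrite mulr_suml; apply: (big_ind H) => // i _.
  rewrite mulr_sumr; apply: (big_ind H) => // j _.
  by apply: (H1 (i + j)%N); rewrite -!addSn; apply: dga_degM.
have HMl x y : H x -> H (y * x).
  move=> [m [f [fP ->]]]; have [n [g [gP ->]]] := dga_deg_sum y.
  rewrite mulr_suml; apply: (big_ind H) => // i _.
  rewrite mulr_sumr; apply: (big_ind H) => // j _.
  by apply: (H1 (i + j)%N); rewrite -!addnS; apply: dga_degM.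
have HQ x y : dspan x -> dspan y -> H (x * y).
  by move=> /Q1 qx /Q1 qy; apply: (H1 0%N); apply: dga_degM qx qy.
have dec x : exists a y z, [/\ dspan y, H z & x = inj a + y + z].
  elim/dga_gen: x.
  - by move=> a; exists a, 0, 0; rewrite !addr0; split=> //; apply: dspan0.
  - move=> a; exists 0, (d (inj a)), 0; split=> //.
      by have := dspan_gen 1 a 1; rewrite rmorph1 mul1r mulr1.
    by rewrite raddf0 add0r addr0.
  - move=> x y [a [u [v [qu hv ->]]]] [b [u' [v' [qu' hv' ->]]]].
    exists (a + b), (u + u'), (v + v'); split; [exact: dspanD|exact: HD|].
    by rewrite rmorphD [LHS]addrACA [in LHS](addrACA (inj a)).
  - move=> x y [a [u [v [qu hv ->]]]] [b [u' [v' [qu' hv' ->]]]].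
    exists (a * b), (inj a * u' + u * inj b),
      (u * u' + (inj a + u) * v' + v * (inj b + u' + v')); split.
    + by apply: dspanD; [apply: Ql|apply: Qr].
    + by apply: (HD _ _ (HD _ _ (HQ _ _ qu qu') (HMl _ _ hv')) (HMr _ _ hv)).
    + rewrite rmorphM [LHS]mulrDl [X in X + _ = _]mulrDr !addrA.
      by congr (_ + _ + _); rewrite mulrDl !mulrDr !addrA.
have Qw : dspan (val w).
  have [a [y [z [qy [n [f [fP ->]]] E]]]] := dec (val w).
  pose g i := match i with 0%N => inj a | 1%N => y - val w | j.+2 => f j end.
  have gP i : g i \in dga_deg Om i.
    case: i => [|[|i]] /=; [exact: dga_inj_deg| |exact: fP].
    by apply: rpredB; [exact: Q1|exact: form_deg].
  have g0 : \sum_(i < n.+2) g i = 0.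
    rewrite 2!big_ord_recl /= E opprD opprD.
    rewrite -[\sum_(i < n) f (0 + i)%N]/(\sum_(i < n) f i).
    by rewrite -[X in _ + X]addrA subrK addrA -opprD subrr.
  have := dga_deg_direct gP g0 (isT : (1 < n.+2)%N) => /= /eqP.
  by rewrite subr_eq0 => /eqP <-.
suff: exists2 v, val w = val v & P v by move=> [v /val_inj ->].
elim: Qw => [|_ _ _ [u -> Pu] _ [v -> Pv]|a b c].
- by exists 0.
- by exists (u + v) => //; apply: PD.
- by exists (a *> dA b <* c).
Qed.

End Forms.

Section Connection.
Context (k : fieldType) (A : algType k) (Om : dga A).
Local Notation Om1 := (diffform Om 1).
Implicit Types (nabla : Om1 -> Om1 ⊗ Om1) (sigma : Om1 ⊗ Om1 -> Om1 ⊗ Om1).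

Record bimodule_connection nabla sigma : Prop := BimoduleConnection {
  conn_linear : linear nabla;
  conn_braid : bimod_morphism sigma;
  conn_left : forall a w, nabla (a *> w) = dA Om a ⊗ w + a *> nabla w;
  conn_right : forall w a, nabla (w <* a) = nabla w <* a + sigma (w ⊗ dA Om a)
}.

Definition torsion_free nabla : Prop :=
  forall w, wedge (nabla w) = form_d w.

End Connection.

Section Jet2Maps.
Context (k : fieldType) (A : algType k) (Om : dga A).
Local Notation Om1 := (diffform Om 1).
Local Notation Om2S := (form2S Om).
Local Notation dA := (dA Om).
Context (nabla : Om1 -> Om1 ⊗ Om1) (sigma : Om1 ⊗ Om1 -> Om1 ⊗ Om1).
Hypotheses (conn : bimodule_connection nabla sigma) (tf : torsion_free nabla).

Lemma sigmaD : {morph sigma : t u / t + u}.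
Proof.
have [sl _ _] := conn_braid conn.
by move=> t u; have := sl 1 t u; rewrite !scale1r.
Qed.

Lemma sigma0 : sigma 0 = 0.
Proof. by apply: (@addIr _ (sigma 0)); rewrite add0r -sigmaD addr0. Qed.

Lemma nablaD : {morph nabla : t u / t + u}.
Proof. by move=> t u; have := conn_linear conn 1 t u; rewrite !scale1r. Qed.

Lemma nabla0 : nabla 0 = 0.
Proof. by apply: (@addIr _ (nabla 0)); rewrite add0r -nablaD addr0. Qed.

Lemma nablaZ c w : nabla (c *: w) = c *: nabla w.
Proof. by have := conn_linear conn c w 0; rewrite !addr0 nabla0 addr0. Qed.

Lemma sigmaZ c t : sigma (c *: t) = c *: sigma t.
Proof.
have [sl _ _] := conn_braid conn.
by have := sl c t 0; rewrite !addr0 sigma0 addr0.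
Qed.

Lemma wedge_nabla_dA a : nabla (dA a) \in @ker_wedge _ _ Om.
Proof. by apply/ker_wedgeP; rewrite tf; apply: val_inj; rewrite /= dga_dd. Qed.

(* The torsion of nabla (w a) and the Leibniz rule for d (w a). *)
Lemma wedge_sigma_dA w a : wedge (w ⊗ dA a + sigma (w ⊗ dA a)) = 0.
Proof.
have := tf (w <* a); rewrite (conn_right conn) wedgeD wedge_ract tf.
move/(congr1 val); rewrite /= (dga_leibniz _ (form_deg w)) expr1 mulN1r.
move/addrI => E; rewrite wedgeD; apply: val_inj.
by rewrite wedgeE /= E subrr.
Qed.

Lemma id_sigma_ker t : t + sigma t \in @ker_wedge _ _ Om.
Proof.
have [_ _ sr] := conn_braid conn.
apply/ker_wedgeP; elim/tensor_ind: t => [|t u IHt IHu|w v].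
- by rewrite sigma0 addr0 wedge0.
- by rewrite sigmaD addrACA wedgeD IHt IHu addr0.
elim/form1_ind: v => [|v v' IHv IHv'|a b c].
- by rewrite -[0](scale0r 0) tens_scaler scale0r sigma0 addr0 wedge0.
- by rewrite tensDr sigmaD addrACA wedgeD IHv IHv' addr0.
- rewrite -ract_tens -tens_bal sr -ractDl wedge_ract wedge_sigma_dA.
  by rewrite ract0.
Qed.

Definition nabla_d (a : A) : Om2S := Form2S (wedge_nabla_dA a).

Definition id_sigma (t : Om1 ⊗ Om1) : Om2S := Form2S (id_sigma_ker t).

Lemma nabla_dM a b :
  nabla_d (a * b) = nabla_d a <* b + id_sigma (dA a ⊗ dA b) + a *> nabla_d b.
Proof.
apply: val_inj; rewrite /= dA_M nablaD (conn_left conn) (conn_right conn).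
by rewrite -!addrA; congr (_ + _); rewrite addrCA.
Qed.

Lemma nabla_dD a b : nabla_d (a + b) = nabla_d a + nabla_d b.
Proof. by apply: val_inj; rewrite /= dA_D nablaD. Qed.

Lemma nabla_dZ c a : nabla_d (c *: a) = c *: nabla_d a.
Proof. by apply: val_inj; rewrite /= dA_Z nablaZ. Qed.

Lemma nabla_d1 : nabla_d 1 = 0.
Proof. by apply: val_inj; rewrite /= dA1 nabla0. Qed.

Lemma id_sigmaD t u : id_sigma (t + u) = id_sigma t + id_sigma u.
Proof. by apply: val_inj; rewrite /= sigmaD addrACA. Qed.

Lemma id_sigma0 : id_sigma 0 = 0.
Proof. by apply: val_inj; rewrite /= sigma0 addr0. Qed.

Lemma id_sigmaZ c t : id_sigma (c *: t) = c *: id_sigma t.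
Proof. by apply: val_inj; rewrite /= sigmaZ scalerDr. Qed.

Lemma id_sigma_lact a t : id_sigma (a *> t) = a *> id_sigma t.
Proof.
have [_ sl _] := conn_braid conn.
by apply: val_inj; rewrite /= sl lactDr.
Qed.

Lemma id_sigma_ract t a : id_sigma (t <* a) = id_sigma t <* a.
Proof.
have [_ _ sr] := conn_braid conn.
by apply: val_inj; rewrite /= sr ractDl.
Qed.

End Jet2Maps.

(* J^2_A = A ⊕ Ω^1 ⊕ Ω^2_S; nabla and sigma only enter the bullet actions. *)
Definition jet2 (k : fieldType) (A : algType k) (Om : dga A) nabla sigma
    of @bimodule_connection k A Om nabla sigma & torsion_free nabla : Type :=
  (A * diffform Om 1 * form2S Om)%type.

Section Jet2.
Context (k : fieldType) (A : algType k) (Om : dga A).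
Local Notation Om1 := (diffform Om 1).
Local Notation dA := (dA Om).
Context (nabla : Om1 -> Om1 ⊗ Om1) (sigma : Om1 ⊗ Om1 -> Om1 ⊗ Om1).
Context (conn : bimodule_connection nabla sigma) (tf : torsion_free nabla).
Local Notation J := (jet2 conn tf).
Local Notation nabla_d := (nabla_d tf).
Local Notation id_sigma := (id_sigma conn tf).

HB.instance Definition _ := GRing.Lmodule.on J.

Definition jet2_lact (a : A) (x : J) : J :=
  let: (s, w, t) := x in
  (a * s, dA a <* s + a *> w, nabla_d a <* s + id_sigma (dA a ⊗ w) + a *> t).

Definition jet2_ract (x : J) (a : A) : J :=
  let: (s, w, t) := x in
  (s * a, s *> dA a + w <* a, s *> nabla_d a + id_sigma (w ⊗ dA a) + t <* a).

Lemma tens0l (w : Om1) : 0 ⊗ w = 0 :> Om1 ⊗ Om1.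
Proof. by rewrite -(scale0r 0) -scale_tens scale0r. Qed.

Lemma tens0r (w : Om1) : w ⊗ 0 = 0 :> Om1 ⊗ Om1.
Proof. by rewrite -(scale0r 0) tens_scaler scale0r. Qed.

Let jet2_eq (s s' : A) (w w' : Om1) (t t' : form2S Om) :
  s = s' -> w = w' -> t = t' -> (s, w, t) = (s', w', t') :> J.
Proof. by move=> -> -> ->. Qed.

Let jet2D (s s' : A) (w w' : Om1) (t t' : form2S Om) :
  (s, w, t) + (s', w', t') = (s + s', w + w', t + t') :> J.
Proof. by []. Qed.

Let jet2Z c (s : A) (w : Om1) (t : form2S Om) :
  c *: (s, w, t) = (c *: s, c *: w, c *: t) :> J.
Proof. by []. Qed.

Let nd1 := nabla_d1 conn tf.
Let ndM := nabla_dM conn tf.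
Let ndD := nabla_dD conn tf.
Let ndZ := nabla_dZ conn tf.

Fact jet2_lact1 v : jet2_lact 1 v = v.
Proof.
case: v => -[s w] t; rewrite /jet2_lact mul1r dA1 nd1 tens0l id_sigma0.
by rewrite !ract0 !lact1 !add0r.
Qed.
Fact jet2_lactM a b v : jet2_lact (a * b) v = jet2_lact a (jet2_lact b v).
Proof.
case: v => -[s w] t /=; apply: jet2_eq;
  first by rewrite mulrA.
  by rewrite dA_M ractDl lactDr !ractM lactM -!addrA lractA.
rewrite ndM dA_M !ractDl tensDl tensDr !id_sigmaD !lactDr ractM lactM lractA.
rewrite -ract_tens id_sigma_ract tens_bal -lact_tens id_sigma_lact -!addrA.
by do 2!congr (_ + _); rewrite addrCA.
Qed.
Fact jet2_lactDl a b v : jet2_lact (a + b) v = jet2_lact a v + jet2_lact b v.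
Proof.
case: v => -[s w] t; rewrite [RHS]jet2D /=; apply: jet2_eq;
  first by rewrite mulrDl.
  by rewrite dA_D ractDl lactDl addrACA.
by rewrite ndD dA_D tensDl id_sigmaD ractDl lactDl [RHS]addrACA
  [X in _ = X + _]addrACA.
Qed.
Fact jet2_lactDr a v w : jet2_lact a (v + w) = jet2_lact a v + jet2_lact a w.
Proof.
case: v w => [[s v] t] [[s' v'] t']; rewrite [RHS]jet2D jet2D /=; apply: jet2_eq;
  first by rewrite mulrDr.
  by rewrite ractDr lactDr addrACA.
by rewrite ractDr tensDr id_sigmaD lactDr [RHS]addrACA
  [X in _ = X + _]addrACA.
Qed.
Fact jet2_lactZl (c : k) a v : jet2_lact (c *: a) v = c *: jet2_lact a v.
Proof.
case: v => -[s w] t; rewrite [RHS]jet2Z /=; apply: jet2_eq;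
  first by rewrite -scalerAl.
  by rewrite dA_Z ractZl lactZl scalerDr.
by rewrite ndZ dA_Z -scale_tens id_sigmaZ ractZl lactZl !scalerDr.
Qed.
Fact jet2_lactZr (c : k) a v : jet2_lact a (c *: v) = c *: jet2_lact a v.
Proof.
case: v => -[s w] t; rewrite [RHS]jet2Z jet2Z /=; apply: jet2_eq;
  first by rewrite -scalerAr.
  by rewrite ractZr lactZr scalerDr.
by rewrite tens_scaler id_sigmaZ ractZr lactZr !scalerDr.
Qed.
Fact jet2_ract1 v : jet2_ract v 1 = v.
Proof.
case: v => -[s w] t; rewrite /jet2_ract mulr1 dA1 nd1 tens0r id_sigma0.
by rewrite !lact0 !ract1 !add0r.
Qed.
Fact jet2_ractM a b v : jet2_ract v (a * b) = jet2_ract (jet2_ract v a) b.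
Proof.
case: v => -[s w] t /=; apply: jet2_eq;
  first by rewrite mulrA.
  by rewrite dA_M lactDr ractDl ractM lactM lractA addrCA !addrA.
rewrite ndM dA_M !ractDl !tensDl !tensDr !id_sigmaD !lactDr ractM lactM lractA.
rewrite -ract_tens id_sigma_ract -tens_bal -lact_tens id_sigma_lact.
exact: (AC (3*2*1) ((3*(2*5))*((1*4)*6))).
Qed.
Fact jet2_ractDl a v w : jet2_ract (v + w) a = jet2_ract v a + jet2_ract w a.
Proof.
case: v w => [[s v] t] [[s' v'] t']; rewrite [RHS]jet2D jet2D /=; apply: jet2_eq;
  first by rewrite mulrDl.
  by rewrite ractDl lactDl addrACA.
by rewrite ractDl tensDl id_sigmaD lactDl [RHS]addrACA
  [X in _ = X + _]addrACA.
Qed.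
Fact jet2_ractDr a b v : jet2_ract v (a + b) = jet2_ract v a + jet2_ract v b.
Proof.
case: v => -[s w] t; rewrite [RHS]jet2D /=; apply: jet2_eq;
  first by rewrite mulrDr.
  by rewrite dA_D ractDr lactDr addrACA.
by rewrite ndD dA_D tensDr id_sigmaD ractDr lactDr [RHS]addrACA
  [X in _ = X + _]addrACA.
Qed.
Fact jet2_ractZl (c : k) a v : jet2_ract (c *: v) a = c *: jet2_ract v a.
Proof.
case: v => -[s w] t; rewrite [RHS]jet2Z jet2Z /=; apply: jet2_eq;
  first by rewrite -scalerAl.
  by rewrite ractZl lactZl scalerDr.
by rewrite -scale_tens id_sigmaZ ractZl lactZl !scalerDr.
Qed.
Fact jet2_ractZr (c : k) a v : jet2_ract v (c *: a) = c *: jet2_ract v a.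
Proof.
case: v => -[s w] t; rewrite [RHS]jet2Z /=; apply: jet2_eq;
  first by rewrite -scalerAr.
  by rewrite dA_Z ractZr lactZr scalerDr.
by rewrite ndZ dA_Z tens_scaler id_sigmaZ ractZr lactZr !scalerDr.
Qed.
Fact jet2_lractA a v b :
  jet2_ract (jet2_lact a v) b = jet2_lact a (jet2_ract v b).
Proof.
case: v => -[s w] t /=; apply: jet2_eq;
  first by rewrite mulrA.
  by rewrite ractDl lactDr ractM lactM lractA addrCA !addrA.
rewrite !ractDl !tensDl !tensDr !id_sigmaD !lactDr ractM lactM !lractA.
rewrite -ract_tens id_sigma_ract tens_bal -lact_tens id_sigma_lact.
exact: (AC (1*2*3) ((4*(2*5))*((1*3)*6))).
Qed.

HB.instance Definition _ := Lmodule_isBimodule.Build k A J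
  jet2_lact1 jet2_lactM jet2_lactDl jet2_lactDr jet2_lactZl jet2_lactZr
  jet2_ract1 jet2_ractM jet2_ractDl jet2_ractDr jet2_ractZl jet2_ractZr
  jet2_lractA.

End Jet2.

(* Main.v *)
Require Import Defs.
From mathcomp Require Import all_boot all_algebra.

(** The bullet actions mention the connection only through [nabla (d a)], and
    two connections with the same generalised braiding have the same Leibniz
    defects: [d a ⊗ w] on the left and [sigma (w ⊗ d a)] on the right. Hence
    the difference [phi = nabla_t - nabla] is a bimodule map
    ([conn_diff_lact], [conn_diff_ract]), and since both connections lift [d]
    through the wedge product, [phi] takes its values in Ω^2_S
    ([conn_diff_ker]).

    The isomorphism is the shear [(s, w, t) |-> (s, w, t + phi w)]. In degree
    two, acting by [a] on [s] makes [phi] meet [(d a) s], which turns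
    [(nabla (d a)) s] into [(nabla_t (d a)) s]; acting on [w] makes it meet
    [a w], which gives [a (phi w)]; the terms in [id + sigma] are common to both
    actions. The shear by [- phi], which is the one obtained by exchanging the
    two connections, is its inverse. *)

Section ConnectionDifference.
Import GRing.Theory.
Local Open Scope ring_scope.
Local Open Scope bimod_scope.
Set Implicit Arguments.
Unset Strict Implicit.

Context (k : fieldType) (A : algType k) (Om : dga A).
Local Notation Om1 := (diffform Om 1).
Context (sigma : Om1 ⊗ Om1 -> Om1 ⊗ Om1).

Section Difference.
Context (nabla nabla_t : Om1 -> Om1 ⊗ Om1).
Context (conn : bimodule_connection nabla sigma) (tf : torsion_free nabla).
Context (conn_t : bimodule_connection nabla_t sigma)
        (tf_t : torsion_free nabla_t).

Lemma conn_diff_ker w : nabla_t w - nabla w \in @ker_wedge _ _ Om.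
Proof.
apply/ker_wedgeP.
by rewrite wedgeD -scaleN1r wedgeZ tf tf_t scaleN1r subrr.
Qed.

Definition conn_diff (w : Om1) : form2S Om := Form2S (conn_diff_ker w).

Lemma conn_diff_linear : linear conn_diff.
Proof.
move=> c u v; apply: val_inj => /=.
rewrite (conn_linear conn) (conn_linear conn_t) scalerBr opprD.
exact: addrACA.
Qed.

Lemma conn_diff_lact a w : conn_diff (a *> w) = a *> conn_diff w.
Proof.
apply: val_inj; rewrite /= (conn_left conn) (conn_left conn_t).
by rewrite lactDr lactN opprD addrACA subrr add0r.
Qed.

(** A right multiplication contributes [sigma (w ⊗ d a)] to both connections,
    which cancels because they share [sigma]. *)
Lemma conn_diff_ract w a : conn_diff (w <* a) = conn_diff w <* a.
Proof.
apply: val_inj; rewrite /= (conn_right conn) (conn_right conn_t).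
by rewrite ractDl ractN opprD addrACA subrr addr0.
Qed.

Lemma nabla_d_diff a : nabla_d tf a + conn_diff (dA Om a) = nabla_d tf_t a.
Proof. by apply: val_inj; rewrite /= addrC subrK. Qed.

(** The proof that id + sigma lands in Ω^2_S uses the connection, but its values
    depend only on [sigma]. *)
Lemma id_sigma_indep t : id_sigma conn tf t = id_sigma conn_t tf_t t.
Proof. exact: val_inj. Qed.

Definition jet2_shear (x : jet2 conn tf) : jet2 conn_t tf_t :=
  let: (s, w, t) := x in (s, w, t + conn_diff w).

Lemma jet2_shear_morphism : bimod_morphism jet2_shear.
Proof.
have phiD u v : conn_diff (u + v) = conn_diff u + conn_diff v.
  by have := conn_diff_linear 1 u v; rewrite !scale1r.
split.
- move=> c [[s w] t] [[s' w'] t'].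
  (* The linear structure of the jets is componentwise by definition. *)
  change ((c *: s + s', c *: w + w', c *: t + t' + conn_diff (c *: w + w'))
    = (c *: s + s', c *: w + w', c *: (t + conn_diff w) + (t' + conn_diff w'))).
  by congr (_, _); rewrite conn_diff_linear scalerDr addrACA.
- move=> a [[s w] t]; congr (_, _).
  rewrite -id_sigma_indep -nabla_d_diff phiD conn_diff_lact conn_diff_ract.
  rewrite ractDl lactDr.
  exact: (AC (3*2) ((1*4)*2*(3*5))).
- move=> [[s w] t] a; congr (_, _).
  rewrite -id_sigma_indep -nabla_d_diff phiD conn_diff_lact conn_diff_ract.
  rewrite ractDl lactDr.
  exact: (AC (3*2) ((1*4)*2*(3*5))).
Qed.

End Difference.

Arguments jet2_shear {nabla nabla_t} conn tf conn_t tf_t x.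

Lemma jet2_shearK nabla nabla_t
    (conn : bimodule_connection nabla sigma) (tf : torsion_free nabla)
    (conn_t : bimodule_connection nabla_t sigma)
    (tf_t : torsion_free nabla_t) :
  cancel (jet2_shear conn tf conn_t tf_t) (jet2_shear conn_t tf_t conn tf).
Proof.
move=> [[s w] t]; congr (_, _); apply: val_inj.
by rewrite /= !addrA subrK addrK.
Qed.

End ConnectionDifference.

Arguments jet2_shear {k A Om sigma nabla nabla_t} conn tf conn_t tf_t x.

Theorem lemma3p2 (k : fieldType) (A : algType k) (Om : dga A)
    (sigma : diffform Om 1 ⊗ diffform Om 1 -> diffform Om 1 ⊗ diffform Om 1)
    (nabla nabla_t : diffform Om 1 -> diffform Om 1 ⊗ diffform Om 1)
    (conn : bimodule_connection nabla sigma) (tf : torsion_free nabla)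
    (conn_t : bimodule_connection nabla_t sigma) (tf_t : torsion_free nabla_t) :
  bimod_isomorphic (jet2 conn tf) (jet2 conn_t tf_t).
Proof.
exists (jet2_shear conn tf conn_t tf_t); first exact: jet2_shear_morphism.
exists (jet2_shear conn_t tf_t conn tf); exact: jet2_shearK.
Qed.
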